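(* For every integer $l\geq 1$, there are only finitely many pairs $(n,q)$, with $n\geq 2$ an integer and $q$ a prime power, such that the length of the shortest non-singular mixed identity for $\mathrm{PSL}_n(q)$ is at most $l$.
   Context: Let $\mathbf{F}_r=\langle x_1,\ldots,x_r\rangle$ be the free group of rank $r$. For a group $G$ and $w\in G\ast\mathbf{F}_r$, $w(h_1,\dots,h_r)$ denotes the image of $w$ under the homomorphism $G\ast\mathbf{F}_r\to G$ which is the identity on $G$ and maps $x_i\mapsto h_i$. An element $w\in G\ast\mathbf{F}_r$ (for some $r\ge 1$) is a mixed identity for $G$ if $w\neq 1$ and $w(h_1,\dots,h_r)=1_G$ for all $h_1,\dots,h_r\in G$. The length of $w$ is the word length on $G\ast\mathbf{F}_r$ assigning length one to the generators $x_1^{\pm1},\dots,x_r^{\pm1}$ and length zero to elements of $G$. The augmentation map $\varepsilon\colon G\ast\mathbf{F}_r\to\mathbf{F}_r$ is the homomorphism that maps every $g\in G$ to $1$ and fixes $\mathbf{F}_r$ elementwise; $w$ is singular if $\varepsilon(w)=1$, and non-singular otherwise. *)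

(* Defs.v *)
From HB Require Import structures.
From mathcomp Require Import all_boot all_order all_algebra all_fingroup.
From mathcomp Require Import all_solvable.
From mathcomp Require Import boolp classical_sets cardinality.

Set Implicit Arguments.
Unset Strict Implicit.
Unset Printing Implicit Defensive.

Local Open Scope group_scope.
Local Open Scope quotient_scope.
Local Notation repr := generic_quotient.repr.

Section Presentation.
Variables (A : choiceType) (R : seq A -> seq A -> Prop).

(* The smallest monoid congruence on words over A that contains R. *)
Inductive pcong : seq A -> seq A -> Prop :=
| pcong_rel s t : R s t -> pcong s t
| pcong_refl s : pcong s s
| pcong_sym s t : pcong s t -> pcong t s
| pcong_trans s t u : pcong s t -> pcong t u -> pcong s u
| pcong_cat s t s' t' : pcong s t -> pcong s' t' -> pcong (s ++ s') (t ++ t').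

Definition pcongb (s t : seq A) : bool := `[< pcong s t >].

Fact pcongb_refl : reflexive pcongb.
Proof. by move=> s; apply/asboolP/pcong_refl. Qed.

Fact pcongb_sym : symmetric pcongb.
Proof.
by move=> s t; apply/idP/idP => /asboolP st; apply/asboolP/pcong_sym.
Qed.

Fact pcongb_trans : transitive pcongb.
Proof.
move=> t s u /asboolP st /asboolP tu; apply/asboolP; exact: pcong_trans tu.
Qed.

Canonical pcong_equiv := EquivRel pcongb pcongb_refl pcongb_sym pcongb_trans.

(* The monoid presented by generators A and relations R. *)
Definition presented := {eq_quot pcong_equiv}.
HB.instance Definition _ := Choice.on presented.

Definition pword (s : seq A) : presented := \pi_presented s.

Lemma pwordP s t : pword s = pword t <-> pcong s t.
Proof.
split=> [/eqP|st]; first by rewrite eqmodE => /asboolP.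
by apply/eqP; rewrite eqmodE; apply/asboolP.
Qed.

Lemma pwordK x : pword (repr (x : presented)) = x.
Proof. exact: reprK. Qed.

Definition pmul (x y : presented) := pword (repr x ++ repr y).

Lemma pmulE s t : pmul (pword s) (pword t) = pword (s ++ t).
Proof. by apply/pwordP/pcong_cat; apply/pwordP; rewrite pwordK. Qed.

Fact pmulA : associative pmul.
Proof.
by move=> x y z; rewrite -(pwordK x) -(pwordK y) -(pwordK z) !pmulE catA.
Qed.

Fact pmul1g : left_id (pword [::]) pmul.
Proof. by move=> x; rewrite -(pwordK x) pmulE. Qed.

Fact pmulg1 : right_id (pword [::]) pmul.
Proof. by move=> x; rewrite -(pwordK x) pmulE cats0. Qed.

HB.instance Definition _ := isMonoid.Build presented pmulA pmul1g pmulg1.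

Lemma pword_cat s t : pword (s ++ t) = pword s * pword t.
Proof. by rewrite [RHS]pmulE. Qed.

Lemma pword_prod s : pword s = \prod_(a <- s) pword [:: a].
Proof.
elim: s => [|a s IHs]; first by rewrite big_nil.
by rewrite big_cons -IHs -pword_cat.
Qed.

(* The extension of f : A -> K to the presented monoid; it is independent of *)
(* the chosen representative as soon as f respects the relations (pliftE).   *)
Definition plift (K : monoidType) (f : A -> K) (x : presented) : K :=
  \prod_(a <- repr x) f a.

Section Lift.
Variables (K : monoidType) (f : A -> K).
Hypothesis fR :
  forall s t, R s t -> \prod_(a <- s) f a = \prod_(a <- t) f a.

Lemma pliftE s : plift f (pword s) = \prod_(a <- s) f a.
Proof.
suff H t u : pcong t u -> \prod_(a <- t) f a = \prod_(a <- u) f a.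
  by apply/H/pwordP; rewrite pwordK.
elim=> {t u} [t u /fR //|//|t u _ -> //|t u v _ -> _ -> //|t u t' u' _ E _ E'].
by rewrite !big_cat /= E E'.
Qed.

Lemma plift_morphism : monoid_morphism (plift f).
Proof.
split=> [|x y]; first by rewrite [1]/(pword [::]) pliftE big_nil.
by rewrite -(pwordK x) -(pwordK y) -pword_cat !pliftE big_cat.
Qed.

End Lift.

Section Inverse.
Variable inv : A -> A.
Hypotheses (Vl : forall a, pcong [:: inv a; a] [::])
           (Vr : forall a, pcong [:: a; inv a] [::]).

Definition pinv (x : presented) := pword (rev (map inv (repr x))).

Fact pmulVg : left_inverse 1 pinv *%g.
Proof.
move=> x; rewrite -{2}(pwordK x) -pword_cat; apply/pwordP.
elim: (repr x) => [|a s IHs] /=; first exact: pcong_refl.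
rewrite rev_cons -cats1 -catA; apply: pcong_trans IHs.
apply: pcong_cat (pcong_refl _) _ => /=; rewrite -[a :: s]cat1s -cat_cons.
by rewrite -{2}[s]cat0s; apply: pcong_cat (Vl a) (pcong_refl _).
Qed.

Fact pmulgV : right_inverse 1 pinv *%g.
Proof.
move=> x; rewrite -{1}(pwordK x) -pword_cat; apply/pwordP.
elim: (repr x) => [|a s IHs] /=; first exact: pcong_refl.
rewrite rev_cons -cats1 catA -cat1s; apply: pcong_trans (Vr a).
rewrite -[[:: a; inv a]]/([:: a] ++ [:: inv a]).
apply: pcong_cat (pcong_refl _) _; rewrite -{2}[[:: inv a]]cat0s.
exact: pcong_cat IHs (pcong_refl _).
Qed.

End Inverse.
End Presentation.

Section FreeGroup.
Variable r : nat.

(* The letter (i, true) stands for x_i and (i, false) for x_i^-1. *)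
Inductive free_rel : seq ('I_r * bool) -> seq ('I_r * bool) -> Prop :=
| FreeRel i b : free_rel [:: (i, b); (i, ~~ b)] [::].

Definition free_group := presented free_rel.
HB.instance Definition _ := Monoid.on free_group.

Let invl (a : 'I_r * bool) := (a.1, ~~ a.2).

Fact free_Vr a : pcong free_rel [:: a; invl a] [::].
Proof. by case: a => i b; apply/pcong_rel/FreeRel. Qed.

Fact free_Vl a : pcong free_rel [:: invl a; a] [::].
Proof.
by case: a => i b; rewrite -{2}[b]negbK; apply/pcong_rel/FreeRel.
Qed.

HB.instance Definition _ := hasInv.Build free_group (pinv invl).
HB.instance Definition _ :=
  Monoid_isGroup.Build free_group (pmulVg free_Vl) (pmulgV free_Vr).

Definition free_gen (i : 'I_r) : free_group := pword free_rel [:: (i, true)].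

Definition free_lift (K : groupType) (h : 'I_r -> K) : free_group -> K :=
  plift (fun a : 'I_r * bool => if a.2 then h a.1 else (h a.1)^-1).

Section Lift.
Variables (K : groupType) (h : 'I_r -> K).

Fact free_lift_rel s t : free_rel s t ->
  \prod_(a <- s) (if a.2 then h a.1 else (h a.1)^-1) =
  \prod_(a <- t) (if a.2 then h a.1 else (h a.1)^-1).
Proof. by case=> i [] /=; rewrite !big_cons big_nil mulg1 (mulgV, mulVg). Qed.

Lemma free_lift_morphism : monoid_morphism (free_lift h).
Proof. exact: plift_morphism free_lift_rel. Qed.

Lemma free_lift_gen i : free_lift h (free_gen i) = h i.
Proof. by rewrite [LHS](pliftE free_lift_rel) big_seq1. Qed.

End Lift.

Lemma free_genV i : (free_gen i)^-1 = pword free_rel [:: (i, false)].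
Proof.
apply: (mulgI (free_gen i)); rewrite mulgV -pword_cat.
exact/esym/pwordP/free_Vr.
Qed.

End FreeGroup.

Section FreeProduct.
Variables G H : groupType.

Inductive fprod_rel : seq (G + H) -> seq (G + H) -> Prop :=
| FProd1l : fprod_rel [:: inl 1] [::]
| FProd1r : fprod_rel [:: inr 1] [::]
| FProdMl g g' : fprod_rel [:: inl g; inl g'] [:: inl (g * g')]
| FProdMr h h' : fprod_rel [:: inr h; inr h'] [:: inr (h * h')].

Definition free_product := presented fprod_rel.
HB.instance Definition _ := Monoid.on free_product.

Let invl (a : G + H) : G + H :=
  match a with inl g => inl g^-1 | inr h => inr h^-1 end.

Fact fprod_Vl a : pcong fprod_rel [:: invl a; a] [::].
Proof.
case: a => x.
  apply: pcong_trans (pcong_rel (FProdMl _ _)) _.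
  by rewrite mulVg; apply/pcong_rel/FProd1l.
apply: pcong_trans (pcong_rel (FProdMr _ _)) _.
by rewrite mulVg; apply/pcong_rel/FProd1r.
Qed.

Fact fprod_Vr a : pcong fprod_rel [:: a; invl a] [::].
Proof.
have: invl (invl a) = a by case: a => x /=; rewrite invgK.
by move=> {1}<-; apply: fprod_Vl.
Qed.

HB.instance Definition _ := hasInv.Build free_product (pinv invl).
HB.instance Definition _ :=
  Monoid_isGroup.Build free_product (pmulVg fprod_Vl) (pmulgV fprod_Vr).

Definition fprod_inl (g : G) : free_product := pword fprod_rel [:: inl g].
Definition fprod_inr (h : H) : free_product := pword fprod_rel [:: inr h].

Lemma fprod_inl_morphism : monoid_morphism fprod_inl.
Proof.
split=> [|g g']; first exact/pwordP/pcong_rel/FProd1l.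
by rewrite -pword_cat; apply/esym/pwordP/pcong_rel/FProdMl.
Qed.

Lemma fprod_inr_morphism : monoid_morphism fprod_inr.
Proof.
split=> [|h h']; first exact/pwordP/pcong_rel/FProd1r.
by rewrite -pword_cat; apply/esym/pwordP/pcong_rel/FProdMr.
Qed.

Definition fprod_lift (K : groupType) (f : G -> K) (g : H -> K) :
    free_product -> K :=
  plift (fun a : G + H => match a with inl x => f x | inr y => g y end).

Section Lift.
Variables (K : groupType) (f : G -> K) (g : H -> K).
Hypotheses (fM : monoid_morphism f) (gM : monoid_morphism g).
Let fg (a : G + H) := match a with inl x => f x | inr y => g y end.

Fact fprod_lift_rel s t : fprod_rel s t ->
  \prod_(a <- s) fg a = \prod_(a <- t) fg a.
Proof.
case=> [||x x'|y y']; rewrite !big_cons !big_nil /= !mulg1.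
- exact: fM.1.
- exact: gM.1.
- by rewrite fM.2.
- by rewrite gM.2.
Qed.

Lemma fprod_lift_morphism : monoid_morphism (fprod_lift f g).
Proof. exact: plift_morphism fprod_lift_rel. Qed.

Lemma fprod_lift_inl x : fprod_lift f g (fprod_inl x) = f x.
Proof. by rewrite [LHS](pliftE fprod_lift_rel) big_seq1. Qed.

Lemma fprod_lift_inr y : fprod_lift f g (fprod_inr y) = g y.
Proof. by rewrite [LHS](pliftE fprod_lift_rel) big_seq1. Qed.

End Lift.
End FreeProduct.

Section MixedIdentities.
Variable G : groupType.

Definition mixed_word (r : nat) : groupType := free_product G (free_group r).

Section Words.
Variable r : nat.
Implicit Types (w : mixed_word r) (h : 'I_r -> G).

Definition mixed_eval h : mixed_word r -> G := fprod_lift id (free_lift h).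

Lemma mixed_eval_morphism h : monoid_morphism (mixed_eval h).
Proof. exact: fprod_lift_morphism (free_lift_morphism h). Qed.

Lemma mixed_eval_const h g : mixed_eval h (fprod_inl _ g) = g.
Proof. exact: fprod_lift_inl (free_lift_morphism h) _. Qed.

Lemma mixed_eval_gen h i : mixed_eval h (fprod_inr _ (free_gen i)) = h i.
Proof.
rewrite [LHS]fprod_lift_inr ?free_lift_gen //.
exact: free_lift_morphism.
Qed.

Definition augmentation : mixed_word r -> free_group r :=
  fprod_lift (fun _ => 1) id.

Fact trivial_morphism : monoid_morphism (fun _ : G => 1 : free_group r).
Proof. by split=> // x y; rewrite mulg1. Qed.

Lemma augmentation_morphism : monoid_morphism augmentation.
Proof. exact: fprod_lift_morphism trivial_morphism _. Qed.

Lemma augmentation_const g : augmentation (fprod_inl _ g) = 1.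
Proof. exact: fprod_lift_inl trivial_morphism _ _. Qed.

Lemma augmentation_free x : augmentation (fprod_inr _ x) = x.
Proof. exact: fprod_lift_inr trivial_morphism _ _. Qed.

Definition mixed_identity w := w <> 1 /\ forall h, mixed_eval h w = 1.

Definition singular w := augmentation w = 1.

Definition nonsingular_mixed_identity w := mixed_identity w /\ ~ singular w.

Definition mixed_letter (a : G + 'I_r * bool) : mixed_word r :=
  match a with
  | inl g => fprod_inl _ g
  | inr (i, true) => fprod_inr _ (free_gen i)
  | inr (i, false) => (fprod_inr _ (free_gen i))^-1
  end.

(* w is a product of constants from G and of exactly k generators x_i^+-1. *)
Definition has_expression w (k : nat) : bool :=
  `[< exists s : seq (G + 'I_r * bool),
        \prod_(a <- s) mixed_letter a = w /\
        count (fun a => ~~ is_inl a) s = k >].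

Fact has_expression_ex w : exists k, has_expression w k.
Proof.
suff [s <-]: exists s, \prod_(a <- s) mixed_letter a = w.
  by exists (count (fun a => ~~ is_inl a) s); apply/asboolP; exists s.
rewrite -(pwordK w); elim: (repr w) => [|a t [s Es]].
  by exists [::]; rewrite big_nil.
suff [s' Es']: exists s', \prod_(a <- s') mixed_letter a =
    pword (@fprod_rel G (free_group r)) [:: a].
  by exists (s' ++ s); rewrite big_cat Es Es' -[a :: t]cat1s pword_cat.
case: a => [g|x]; first by exists [:: inl g]; rewrite big_seq1.
have inrM := fprod_inr_morphism G (free_group r).
rewrite -[pword _ _]/(fprod_inr G x) -(pwordK x).
elim: (repr x) => [|[i b] u [v Ev]].
  by exists [::]; rewrite big_nil -[pword _ _]/(1 : free_group r) inrM.1.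
exists (inr (i, b) :: v); rewrite big_cons Ev -[(i, b) :: u]cat1s pword_cat.
rewrite inrM.2; congr (_ * _); case: b => //=; rewrite -free_genV.
by apply: (mulgI (fprod_inr G (free_gen i))); rewrite mulgV -inrM.2 mulgV inrM.1.
Qed.

(* The word length on G * F_r for which x_i^+-1 has length one and the *)
(* elements of G have length zero.                                     *)
Definition mixed_length w : nat := ex_minn (has_expression_ex w).

End Words.

Definition has_nonsingular_identity_of_length (k : nat) : bool :=
  `[< exists (r : nat) (w : mixed_word r),
        [/\ (1 <= r)%N, nonsingular_mixed_identity w & mixed_length w = k] >].

End MixedIdentities.

(* x_1^#|G| is a non-singular identity for the finite group G. *)
Fact nonsingular_identity_ex (G : finGroupType) :
  exists k, has_nonsingular_identity_of_length G k.
Proof.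
pose x : free_group 1 := free_gen ord0.
have inrM := fprod_inr_morphism G (free_group 1).
pose w : mixed_word G 1 := fprod_inr G (x ^+ #|G|).
have augw : augmentation w <> 1.
  rewrite augmentation_free => xG.
  pose h (_ : 'I_1) : 'I_#|G|.+2 := Zp1.
  have hM := free_lift_morphism h.
  have hX n : free_lift h (x ^+ n) = Zp1 ^+ n.
    elim: n => [|n IHn]; first by rewrite !expg0 hM.1.
    by rewrite !expgS hM.2 IHn free_lift_gen.
  have := hX #|G|; rewrite xG hM.1 Zp_expg => /(congr1 val) /=.
  rewrite mul1n modn_small; last by rewrite ltnS leqnSn.
  by move=> G0; have:= fintype0 (1 : G) (esym G0).
exists (mixed_length w); apply/asboolP; exists 1%N, w; split=> //.
split=> //; split=> [w1|h].
  by apply: augw; rewrite w1; apply: (augmentation_morphism _ _).1.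
have eM := mixed_eval_morphism h.
have eX n : mixed_eval h (fprod_inr G (x ^+ n)) = h ord0 ^+ n.
  elim: n => [|n IHn]; first by rewrite !expg0 inrM.1 eM.1.
  by rewrite !expgS inrM.2 eM.2 IHn mixed_eval_gen.
by rewrite eX -cardsT; apply: expg_cardG; rewrite inE.
Qed.

Definition shortest_nonsingular_length (G : finGroupType) : nat :=
  ex_minn (nonsingular_identity_ex G).

Section PSL.
Variables (n : nat) (F : finFieldType).

(* {'GL_n[F]} consists of matrices of size n.-1.+1, that is n for 0 < n. *)
Definition SL : {set {'GL_n[F]}} := [set u | (\det (GLval u) == 1)%R].

Fact SL_group_set : group_set SL.
Proof.
apply/group_setP; split=> [|u v]; first by rewrite inE GL_1E det1.
by rewrite !inE GL_ME detM => /eqP-> /eqP->; rewrite GRing.mulr1.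
Qed.
Canonical SL_group := Group SL_group_set.

Definition PSL : {group coset_of 'Z(SL)} := (SL / 'Z(SL))%G.

End PSL.

Definition prime_power (q : nat) : Prop :=
  exists p k : nat, [/\ prime p, (0 < k)%N & q = (p ^ k)%N].

(* Main.v *)
Require Import Defs.
From mathcomp Require Import all_boot all_order all_algebra all_fingroup.
From mathcomp Require Import all_solvable mxabelem zify.
From mathcomp Require Import boolp classical_sets cardinality.

(* Lift a mixed word to constants in SL_n(q). If an interior constant c of a *)
(* subword x c x^-1 is within rank T of a scalar, cancelling x against x^-1   *)
(* changes the values of the word by rank at most T, up to scalars, and keeps *)
(* its augmentation. By induction on the length one may thus assume that all  *)
(* such constants are far from scalars; non-singularity ensures that letters  *)
(* remain. For n large (and any q), one then picks vectors generically along  *)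
(* the paths that the word describes, so that they prescribe the variables on *)
(* independent vectors and move the starting points far away. For q large     *)
(* (and any n >= 2), T = 0 and one substitutes for x_i a product of two       *)
(* transvections 1 + t E; the value is polynomial in t, and for generic E its *)
(* leading coefficient has rank one, so it is not a scalar matrix for all t.  *)

Set Implicit Arguments.
Unset Strict Implicit.
Unset Printing Implicit Defensive.
Import GRing.Theory.
Local Open Scope ring_scope.

(** * Mixed words and cancellation *)

(** It suffices to bound n and q separately. A mixed word over PSL_n(q) lifts to constants in
    SL_n(q), and it is not an identity once some substitution in SL_n(q) gives the lift a non-scalar
    value ([not_mixed_identity]). For at most l letters and non-trivial augmentation, such a
    substitution exists if n >= N(l), for all q ([large_rank]), and if q > 9l, for all n >= 2
    ([large_field]).

    The obstruction is a subword x c x^-1 with c close to a scalar; [cancel_letters] removes x and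
    x^-1 at the cost of an error of small rank. For words without such subwords there are two
    constructions. For large n, [spaced_far] traces T+1 generic vectors through the word. Their
    existence is a counting argument ([generic_vectors]), and the prescribed values of each variable
    extend to a matrix of determinant one ([family_extend_SL]). For large q, [spaced0_far] attaches
    a square-zero matrix E_x = c_x v_x to every signed letter x and replaces x_i by (1 + t E_y)(1 +
    t E_x), where x = x_i and y = x_i^-1. The top coefficient in t is a product of rank-one
    matrices, which is non-zero if all scalars v g c between neighbouring factors are;
    [generic_params] makes them so. *)

Section Words.
Variables (F : finFieldType) (n r : nat).
Implicit Types (h : 'I_r -> 'M[F]_n) (g A : 'M[F]_n).
Implicit Types (x : 'I_r * bool) (s : seq (('I_r * bool) * 'M[F]_n)).

Definition letter_mx h x := if x.2 then h x.1 else invmx (h x.1).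

(* The pair of g and [:: (x1, c1); ...; (xk, ck)] encodes the mixed word *)
(* g x1 c1 ... xk ck.                                                   *)
Definition word_mx h g s :=
  foldl (fun A a => A *m letter_mx h a.1 *m a.2) g s.

Definition letters s := pword (@free_rel r) (map fst s).

Definition const_SL g s := \det g = 1 /\ {in s, forall a, \det a.2 = 1}.

(** For [T = 0] this means non-scalar, which is what PSL detects; larger [T] leave room for the
    errors of cancellation. *)
Definition far T g := [forall a : F, (T < \rank (g - a%:M)%R)%N].

Definition spaced T (a b : ('I_r * bool) * 'M[F]_n) :=
  (b.1 == (a.1.1, ~~ a.1.2)) ==> far T a.2.

Lemma word_mxM h A g s : word_mx h (A *m g) s = A *m word_mx h g s.
Proof. by elim: s g => //= a s IHs g; rewrite -!mulmxA IHs. Qed.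

Lemma letter_mxV h x : h x.1 \in unitmx ->
  letter_mx h x *m letter_mx h (x.1, ~~ x.2) = 1%:M.
Proof.
by rewrite /letter_mx; case: x => i [] /= hu; rewrite ?mulmxV ?mulVmx.
Qed.

Lemma far_perturb T T' a g g' : a != 0 -> (\rank (g - a *: g')%R <= T')%N ->
  far (T + T') g' -> far T g.
Proof.
move=> a0 le_T' /forallP far_g'; apply/forallP => b.
have := far_g' (b / a); rewrite -(mxrank_scale_nz _ a0).
have -> : a *: (g' - (b / a)%:M) = (g - b%:M) - (g - a *: g').
  rewrite scalerBr scale_scalar_mx mulrCA divff // mulr1 opprB.
  by rewrite [RHS]addrC addrA subrK.
move=> /leq_trans/(_ (mxrank_add _ _)); rewrite mxrank_opp => lt.
rewrite -(ltn_add2r T'); apply: leq_trans lt _.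
by rewrite leq_add2l.
Qed.

(** Write the constant of a violating subword x c x^-1 as K plus a scalar, with K of rank at most
    [T]. In the scalar part x cancels against x^-1; the other part is a product with factor K, hence
    of rank at most [T]. *)
Lemma cancel_letters T g s : (T < n)%N -> const_SL g s ->
    ~~ sorted (spaced T) s ->
  exists g' s', [/\ size s = (size s').+2, const_SL g' s',
    letters s = letters s' &
    forall h, (forall i, h i \in unitmx) ->
      exists2 a : F, a != 0 &
        (\rank (word_mx h g s - a *: word_mx h g' s')%R <= T)%N].
Proof.
move=> ltTn; elim: s g => [|a [|b s] IHs] g //= [dg ds].
have da : \det a.2 = 1 by apply: ds; rewrite mem_head.
have db : \det b.2 = 1 by apply: ds; rewrite !inE eqxx orbT.
have dbs : {in b :: s, forall a, \det a.2 = 1}.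
  by move=> c cs; apply: ds; rewrite inE cs orbT.
have ds' : {in s, forall a, \det a.2 = 1}.
  by move=> c cs; apply: dbs; rewrite inE cs orbT.
rewrite negb_and => /orP[|nsp]; last first.
  have [g' [s' [szs [dg' ds''] ls hs]]] := IHs a.2 (conj da dbs) nsp.
  exists g, ((a.1, g') :: s'); split.
  - by move: szs => /= ->.
  - by split=> // c; rewrite inE => /predU1P[->//|/ds''].
  - rewrite /letters /= -cat1s -[a.1 :: map _ s']cat1s !pword_cat.
    by congr (_ * _)%g.
  - move=> h hu; have [c c0 le] := hs h hu; exists c => //.
    have wE d t : word_mx h (g *m letter_mx h a.1 *m d) t =
      (g *m letter_mx h a.1) *m word_mx h d t by exact: word_mxM.
    set A := g *m letter_mx h a.1 in wE.
    suff : (\rank (A *m word_mx h a.2 (b :: s) - c *: (A *m word_mx h g' s'))%R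
        <= T)%N by rewrite -!wE.
    rewrite scalemxAr -mulmxBr; exact: leq_trans (mxrankM_maxr _ _) le.
rewrite negb_imply => /andP[/eqP ba]; rewrite negb_forall => /existsP[c].
rewrite -leqNgt => le.
exists (g *m b.2), s; split=> //.
- by split=> //; rewrite det_mulmx dg db mulr1.
- rewrite /letters /= ba; apply/pwordP.
  rewrite -[X in pcong _ _ X]cat0s -[[:: _, _ & _]]/([:: _; _] ++ _).
  apply: pcong_cat (pcong_refl _ _); rewrite [X in X :: _]surjective_pairing.
  exact/pcong_rel/FreeRel.
- move=> h hu; exists c.
    (* Were the scalar zero, the constant itself would have rank at most [T < n], against
       determinant one. *)
    apply: contraTneq ltTn => c0; rewrite -leqNgt.
    apply: leq_trans le; rewrite c0 raddf0 subr0 mxrank_unit //.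
    by rewrite unitmxE da unitr1.
  set x := letter_mx h a.1; set y := letter_mx h b.1.
  have xy : x *m y = 1%:M by rewrite /y ba letter_mxV.
  rewrite -/(word_mx h (g *m x *m a.2 *m y *m b.2) s).
  rewrite -{1}[a.2](subrK c%:M); move: (a.2 - c%:M)%R le => K le.
  rewrite !mulmxDr !mulmxDl.
  rewrite mul_mx_scalar -!scalemxAl -(mulmxA g x y) xy mulmx1.
  have wD A B : word_mx h (A + B) s = word_mx h A s + word_mx h B s.
    by elim: (s) A B => //= d s1 IH A B; rewrite !mulmxDl IH.
  have wZ A : word_mx h (c *: A) s = c *: word_mx h A s.
    by elim: (s) A => //= d s1 IH A; rewrite -!scalemxAl IH.
  rewrite wD wZ addrK.
  have -> : g *m x *m K *m y *m b.2 =
    (g *m x) *m K *m (y *m b.2) by rewrite !mulmxA.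
  rewrite word_mxM; apply: leq_trans (mxrankM_maxl _ _) _.
  exact: leq_trans (mxrankM_maxr _ _) le.
Qed.

End Words.

(** * Large rank *)

Section Extension.
Variable F : fieldType.

Lemma row_free_complete m d (S : 'M[F]_(m, m + d)) : row_free S ->
  exists2 P, P \in unitmx & S = row_mx 1%:M 0 *m P.
Proof.
move=> /eqP rS; exists (block_mx (col_ebase S) 0 0 1%:M *m row_ebase S).
  by rewrite unitmx_mul row_ebase_unit unitmxE det_lblock det1 mulr1 -unitmxE
    col_ebase_unit.
rewrite mulmxA mul_row_block !mul0mx !mul1mx !addr0.
by rewrite -{1}[S]mulmx_ebase rS pid_mx_row mul_mx_row mulmx1 mulmx0.
Qed.

(** Complete [S] and [D] to invertible matrices; since m < n, a spare basis vector can be rescaled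
    to correct the determinant. *)
Lemma row_free_extend_SL m n (S D : 'M[F]_(m, n)) :
  (m < n)%N -> row_free S -> row_free D ->
  exists2 H, \det H = 1 & S *m H = D.
Proof.
move=> lt_mn; have [d En] : {d | n = m + (1 + d)}%N.
  by exists (n - m.+1)%N; rewrite addnA addn1 subnKC.
clear lt_mn; subst n.
move=> /row_free_complete[P uP ->] /row_free_complete[Q uQ ->].
pose a := \det P / \det Q.
pose Z : 'M[F]_(m + (1 + d)) := block_mx 1%:M 0 0 (block_mx a%:M 0 0 1%:M).
exists (invmx P *m Z *m Q).
  rewrite !det_mulmx det_inv !det_lblock !det1 det_scalar1 mul1r mulr1 /a.
  by move: uP uQ; rewrite !unitmxE => uP uQ; rewrite mulKr // mulVr.
rewrite -!mulmxA (mulmxA P) mulmxV // mul1mx mulmxA; congr (_ *m _).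
by rewrite mul_row_block !mulmx0 !mul0mx !addr0 mul1mx.
Qed.

Lemma family_extend_SL n (J : finType) (A : {set J}) (f g : J -> 'rV[F]_n) :
    (#|A| < n)%N ->
    (forall V : J -> F, \sum_(p in A) V p *: f p = 0 ->
       {in A, forall p, V p = 0}) ->
    (forall V : J -> F, \sum_(p in A) V p *: g p = 0 ->
       {in A, forall p, V p = 0}) ->
  exists2 H, \det H = 1 & {in A, forall p, f p *m H = g p}.
Proof.
move=> ltAn free_f free_g.
pose M (f : J -> 'rV[F]_n) := \matrix_(j < #|A|) f (enum_val j).
have freeM e : (forall V : J -> F, \sum_(p in A) V p *: e p = 0 ->
       {in A, forall p, V p = 0}) -> row_free (M e).
  move=> free_e; apply: inj_row_free => v.
  pose V p := oapp (v 0) 0 [pick j : 'I_#|A| | enum_val j == p].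
  have VE j : V (enum_val j) = v 0 j.
    rewrite /V; case: pickP => [k /eqP/enum_val_inj-> //|/(_ j)].
    by rewrite eqxx.
  rewrite mulmx_sum_row => v0; apply/rowP => j; rewrite mxE -VE.
  apply: free_e (enum_valP j); rewrite (big_enum_val (fun p => V p *: e p)).
  by rewrite -[RHS]v0; apply: eq_bigr => k _; rewrite VE rowK.
have [H dH MH] := row_free_extend_SL ltAn (freeM _ free_f) (freeM _ free_g).
exists H => // p pA; have := congr1 (row (enum_rank_in pA p)) MH.
by rewrite row_mul !rowK enum_rankK_in.
Qed.

End Extension.

(** * Generic vectors by counting *)

Section GenericVectors.
Variables (F : finFieldType) (n : nat).

(** Modulo [U], this set is the kernel of a matrix of rank at least rank X - rank U > d. *)
Lemma card_preim_rowspace m (X : 'M[F]_n) (U : 'M[F]_(m, n)) d :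
  (\rank U + d < \rank X)%N ->
  (#|[set b : 'rV[F]_n | (b *m X <= U)%MS]| <= #|F| ^ (n - d.+1))%N.
Proof.
move=> lt_rank; have -> : [set b : 'rV[F]_n | (b *m X <= U)%MS] =
    rowg (kermx (X *m cokermx U)).
  by apply/setP => b; rewrite !inE submxE -mulmxA sub_kermx.
rewrite card_rowg mxrank_ker; apply: leq_pexp2l.
  by apply/card_gt0P; exists 0.
apply: leq_sub2l.
have := mxrank_mul_min X (cokermx U); rewrite mxrank_coker.
apply: leq_trans; have := rank_leq_col U; have := rank_leq_col X.
move: lt_rank; move: (\rank X) (\rank U) => x u lt_ux le_xn le_un.
lia.
Qed.

(* Each b j avoids the preimages under x + y G_j of the span of the earlier *)
(* b k and b k G_k, for the fewer than q ^ 2 admissible pairs (x, y).       *)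
Lemma generic_vectors (J : eqType) (s : seq J) (G : J -> 'M[F]_n) T :
    uniq s -> (2 * size s <= T)%N -> (T < n)%N ->
    (forall j, G j \in unitmx) ->
  exists b : J -> 'rV[F]_n, forall u v : J -> F,
    {in s, forall j, u j != 0 -> v j != 0 -> far T (G j)} ->
    \sum_(j <- s) (u j *: b j + v j *: (b j *m G j)) = 0 ->
    {in s, forall j, u j = 0 /\ v j = 0}.
Proof.
move=> + + ltTn Gu; elim: s => [|j s IHs] /=; first by exists (fun=> 0).
case/andP => jNs uniq_s le_sT.
have [|b gen_b] := IHs uniq_s.
  by apply: leq_trans le_sT; rewrite leq_mul2l leqnSn orbT.
pose U := (\sum_(k <- s) (<<b k>> + <<b k *m G k>>))%MS.
have rU : (\rank U <= 2 * size s)%N.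
  rewrite /U; elim: (s) => [|k t IHt]; first by rewrite big_nil mxrank0.
  rewrite big_cons mulnS; apply: leq_trans (mxrank_adds_leqif _ _) _.
  apply: leq_add IHt; apply: leq_trans (mxrank_adds_leqif _ _) _.
  by rewrite !mxrank_gen (leq_add (rank_leq_row _) (rank_leq_row _)).
pose ok (p : F * F) := (p != 0) && ((p.1 != 0) ==> (p.2 != 0) ==> far T (G j)).
pose X (p : F * F) := p.1%:M + p.2 *: G j.
have rX p : ok p -> (T < \rank (X p))%N.
  case: p => x y; rewrite /ok /X /= => /andP[].
  rewrite xpair_eqE negb_and; have [->|y0] := eqVneq y 0.
    rewrite orbF => x0 _; rewrite scale0r addr0 mxrank_unit //.
    by rewrite unitmxE det_scalar unitrX // unitfE.
  rewrite orbT => _; have [->|x0 /=] := eqVneq x 0.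
    rewrite (raddf0 (@scalar_mx F n)) add0r => _.
    by rewrite mxrank_scale_nz // mxrank_unit.
  move/forallP/(_ (- x / y)); rewrite -(mxrank_scale_nz _ y0) scalerBr.
  by rewrite scale_scalar_mx mulrC divfK // rmorphN opprK addrC.
pose bad := \bigcup_(p in ok) [set c : 'rV[F]_n | (c *m X p <= U)%MS].
have lt_bad : (#|bad| < #|{: 'rV[F]_n}|)%N.
  have q_gt1 : (1 < #|F|)%N := card_finNzRing_gt1 F.
  (* At most q^2 pairs exclude at most q^(n-3) vectors each: [U] has rank at most T - 2, and every
     [X p] has rank above T. *)
  apply: (@leq_ltn_trans (\sum_(p in ok) #|F| ^ (n - 3))%N).
    rewrite /bad; apply: (big_ind2 (fun (A : {set _}) m => #|A| <= m)%N).
    - by rewrite cards0.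
    - move=> A1 m1 A2 m2 le1 le2; apply: leq_trans (leq_add le1 le2).
      by rewrite cardsU leq_subr.
    - move=> p okp; apply: card_preim_rowspace.
      apply: leq_trans (rX p okp); rewrite ltnS.
      apply: leq_trans le_sT; rewrite mulnS addnC leq_add2l.
      exact: rU.
  rewrite sum_nat_const card_mx mul1n.
  apply: (@leq_ltn_trans (#|F| ^ 2 * #|F| ^ (n - 3))%N).
    by rewrite leq_mul2r -[(#|F| ^ 2)%N]card_prod max_card orbT.
  rewrite -expnD ltn_exp2l //; lia.
have [c] : exists c, c \notin bad.
  apply/existsP; rewrite -negb_forall; apply: contraL lt_bad.
  move/forallP => all_bad; rewrite -leqNgt.
  by apply/subset_leq_card/fintype.subsetP => x _.
move=> /finset.bigcupP c_good; exists (fun k => if k == j then c else b k).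
move=> u v far_uv.
rewrite big_cons eqxx => sum0.
have sE : \sum_(k <- s) (u k *: (if k == j then c else b k)
      + v k *: ((if k == j then c else b k) *m G k)) =
    \sum_(k <- s) (u k *: b k + v k *: (b k *m G k)).
  apply: eq_big_seq => k ks; case: eqP => // kj.
  by rewrite -kj ks in jNs.
have sumU :
    ((\sum_(k <- s) (u k *: b k + v k *: (b k *m G k)))%R <= U)%MS.
  rewrite /U; elim: (s) => [|k t IHt]; first by rewrite !big_nil sub0mx.
  rewrite !big_cons /=; apply: addmx_sub_adds => //.
  by rewrite addmx_sub_adds ?scalemx_sub // genmxE.
have uvj : (u j, v j) = 0.
  apply: contrapT => /eqP uv0; apply: c_good; exists (u j, v j).
    rewrite unfold_in /ok uv0 /=; apply/implyP => uj0; apply/implyP => vj0.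
    by apply: far_uv => //; rewrite mem_head.
  rewrite inE /X /= mulmxDr mul_mx_scalar -scalemxAr.
  move/eqP: sum0; rewrite sE addr_eq0 => /eqP->.
  by rewrite -scaleN1r scalemx_sub.
case: uvj => uj vj; move: sum0; rewrite uj vj !scale0r !add0r sE => sum0.
move=> k; rewrite inE => /predU1P[->//|ks]; apply: gen_b ks => //.
by move=> i si; apply: far_uv; rewrite inE si orbT.
Qed.

End GenericVectors.

(** * Tracing paths through a spaced word *)

Section LargeRank.
Variables (F : finFieldType) (n r : nat).
Implicit Types s : seq (('I_r * bool) * 'M[F]_n).

(** The generic vectors, arranged as T+1 paths of L+1 vectors; indexing by [nat] allows the shift
    from k to k.+1 without casts. *)
Lemma generic_paths T T' (L : nat) (G : nat -> 'M[F]_n) :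
    (2 * (L.+1 * T.+1) <= T')%N -> (T' < n)%N -> (forall k, G k \in unitmx) ->
  exists B : nat -> 'I_T.+1 -> 'rV[F]_n,
    forall u v : nat -> 'I_T.+1 -> F,
    (forall k c, (k <= L)%N -> u k c != 0 -> v k c != 0 -> far T' (G k)) ->
    \sum_(k < L.+1) \sum_c (u k c *: B k c + v k c *: (B k c *m G k)) = 0 ->
    forall k c, (k <= L)%N -> u k c = 0 /\ v k c = 0.
Proof.
move=> le_LT lt_Tn Gu; pose J := ('I_L.+1 * 'I_T.+1)%type.
have [||b gen_b] := @generic_vectors F n J (index_enum J)
    (fun j => G j.1) T' (index_enum_uniq _) _ lt_Tn.
- apply: leq_trans le_LT; rewrite leq_mul2l /=.
  by rewrite -sum1_size sum1_card card_prod !card_ord.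
- by move=> j; apply: Gu.
exists (fun k c => b (inord k, c)) => u v far_uv sum0 k c le_kL.
have := gen_b (fun j => u j.1 j.2) (fun j => v j.1 j.2) _ _ (inord k, c) _.
rewrite /= inordK //; apply; last exact: mem_index_enum.
  by move=> [i d] _ /=; apply: far_uv; rewrite -ltnS.
rewrite -[RHS]sum0 pair_big /=; apply: eq_bigr => -[i d] _ /=.
by rewrite inord_val.
Qed.

(** Letter k is asked to carry [B k c *m G k] to [B k.+1 c]. For each variable these demands have
    independent sources and independent targets, so a matrix of determinant one meets them. The word
    then sends [B 0 c] to [B L c *m G L]. *)
Lemma spaced_far T T' g s :
    (2 * ((size s).+1 * T.+1) <= T')%N -> (T' < n)%N -> (0 < size s)%N ->
    const_SL g s -> sorted (spaced T') s ->
  exists2 h, forall i, \det (h i) = 1 & far T (word_mx h g s).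
Proof.
move=> leT ltTn s_gt0 [dg ds] sp.
have a0 : ('I_r * bool) * 'M[F]_n by case: (s) s_gt0.
set L := size s in leT *.
pose G k := nth 1%:M (g :: map snd s) k.
have Gu k : G k \in unitmx.
  rewrite unitmxE; suff -> : \det (G k) = 1 by exact: unitr1.
  rewrite /G; case: (ltnP k (size (g :: map snd s))) => [lt_k|le_k].
    have := mem_nth 1%:M lt_k; rewrite inE => /predU1P[->//|/mapP[a /ds da ->]].
    exact: da.
  by rewrite nth_default ?det1.
have [B gen_B] := generic_paths leT ltTn Gu.
pose x k := (nth a0 s k).1.
(* [w true] lists the sources and [w false] the targets of the variables. *)
pose w e k c := if (x k).2 == e then B k c *m G k else B k.+1 c.
pose A i := [set p : 'I_L * 'I_T.+1 | (x p.1).1 == i].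
have ltA i : (#|A i| < n)%N.
  apply: leq_ltn_trans (max_card _) _; rewrite card_prod !card_ord.
  by move: leT ltTn; rewrite (mulSn L); move: (L * T.+1)%N => m; lia.
have free_w i e (V : 'I_L * 'I_T.+1 -> F) :
  \sum_(p in A i) V p *: w e p.1 p.2 = 0 -> {in A i, forall p, V p = 0}.
  move=> sum0.
  pose W k c := if insub k is Some k'
    then if (k', c) \in A i then V (k', c) else 0 else 0.
  have WE (k : 'I_L) c : W k c = if (k, c) \in A i then V (k, c) else 0.
    by rewrite /W valK.
  have W0 k c : W k c != 0 -> (k < L)%N /\ (x k).1 = i.
    rewrite /W; case: insubP => [k' ltk <-|]; last by rewrite eqxx.
    case: ifP => [|_]; last by rewrite eqxx.
    by rewrite inE /= => /eqP-> _; rewrite ltn_ord.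
  (* Rewrite the relation in terms of all [B k c] and [B k c *m G k]; [u] is shifted by one because
     a letter of the other sign contributes [B k.+1 c]. *)
  pose v k c := if (x k).2 == e then W k c else 0.
  pose u k c := if k is k'.+1 then if (x k').2 == e then 0 else W k' c else 0.
  have uv0 : forall k c, (k <= L)%N -> u k c = 0 /\ v k c = 0.
    apply: gen_B => [[|k] c _|]; rewrite {1}/u; first by rewrite eqxx.
      rewrite /v; have [|xk] /= := eqVneq (x k).2 e; first by move=> _ /eqP.
      move=> /W0[_ xki]; have [xk'|_ /eqP//] := eqVneq (x k.+1).2 e.
      (* Both vectors at index k+1 occur only if letter k+1 is the inverse of letter k; then spacing
         makes the constant between them far from scalars. *)
      move=> /W0[ltk xki']; have /sortedP/(_ k ltk) := sp.
      move=> /(_ a0); rewrite /spaced -/(x k) -/(x k.+1).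
      have -> : x k.+1 == ((x k).1, ~~ (x k).2).
        rewrite [x k.+1]surjective_pairing xki xki' xk' xpair_eqE eqxx /=.
        by move: xk; case: (x k).2; case: (e).
      by rewrite /G /= (nth_map a0) // ltnW.
    rewrite -[RHS]sum0.
    under eq_bigr do rewrite big_split /=.
    rewrite big_split /= big_ord_recl /= big1 ?add0r; last first.
      by move=> c _; rewrite scale0r.
    rewrite [X in _ + X]big_ord_recr /= [X in _ + (_ + X)]big1 ?addr0; last first.
      by move=> c _; rewrite /v /W insubF ?ltnn // if_same scale0r.
    rewrite -big_split /= [RHS]big_mkcond /=.
    transitivity (\sum_(k < L) \sum_c
        (if (k, c) \in A i then V (k, c) *: w e k c else 0)); last first.
      by rewrite pair_big; apply: eq_bigr => -[].
    apply: eq_bigr => k _; rewrite -big_split; apply: eq_bigr => c _ /=.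
    rewrite /v /w !add0n WE; case: ((k, c) \in A i); case: ((x k).2 == e) => /=.
    - by rewrite scale0r add0r.
    - by rewrite scale0r addr0.
    - by rewrite !scale0r addr0.
    - by rewrite !scale0r addr0.
  move=> [k c] pA; have := uv0 k c (ltnW (ltn_ord k)); rewrite /v WE pA.
  have := uv0 k.+1 c (ltn_ord k); rewrite /u WE pA.
  by case: eqP => _ [] // ? _ [].
have /choice[h hP] i : exists H : 'M[F]_n, \det H = 1 /\
    {in A i, forall p : 'I_L * 'I_T.+1, w true p.1 p.2 *m H = w false p.1 p.2}.
  have [H dH wH] := family_extend_SL (ltA i) (free_w i true) (free_w i false).
  by exists H.
have hu i : h i \in unitmx by rewrite unitmxE (hP i).1 unitr1.
exists h => [i|]; first by case: (hP i).
have step k c : (k < L)%N -> B k c *m G k *m letter_mx h (x k) = B k.+1 c.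
  move=> ltk; have := (hP (x k).1).2 (Ordinal ltk, c).
  rewrite inE eqxx => /(_ isT); rewrite /w /letter_mx /=.
  by case: (x k).2 => //= <-; rewrite mulmxK.
have walk k c : (k <= L)%N -> B 0 c *m word_mx h g (take k s) = B k c *m G k.
  elim: k => [|k IHk] ltk; first by rewrite take0.
  rewrite (take_nth a0 ltk) /word_mx foldl_rcons -/(word_mx h g (take k s)).
  rewrite !mulmxA IHk 1?ltnW // step //; congr (_ *m _).
  by rewrite /G /= (nth_map a0).
apply/forallP => a; set W := word_mx h g s.
pose M := \matrix_(c < T.+1) B 0 c.
suff : row_free (M *m (W - a%:M)).
  rewrite /row_free => /eqP rM; have := mxrankM_maxr M (W - a%:M).
  by rewrite rM.
apply: inj_row_free => z zM.
pose u k c := if k == 0%N then - a * z 0 c else 0.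
pose v k c := if k == L then z 0 c else 0.
have uv0 : forall k c, (k <= L)%N -> u k c = 0 /\ v k c = 0.
  apply: gen_B => [k c _|].
    rewrite /u /v; have [->|_ /eqP//] := eqVneq k 0%N; move=> _.
    by rewrite ltn_eqF // eqxx.
  rewrite -[RHS]zM; under eq_bigr do rewrite big_split /=.
  rewrite big_split /= big_ord_recl /= [X in _ + X + _]big1 ?addr0; last first.
    by move=> k _; rewrite big1 // => c _; rewrite scale0r.
  rewrite [X in _ + X]big_ord_recr /= [X in _ + (X + _)]big1 ?add0r; last first.
    move=> k _; rewrite big1 // => c _; rewrite /v.
    by rewrite (ltn_eqF (ltn_ord k)) scale0r.
  rewrite mulmxBr mulmxBr mul_mx_scalar -scalemxAr [RHS]addrC.
  rewrite !(mulmx_sum_row z) scaler_sumr -sumrN; congr (_ + _).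
    by apply: eq_bigr => c _; rewrite /u /= mulNr scaleNr scalerA rowK.
  apply: eq_bigr => c _; rewrite /v eqxx -walk // take_size -/W.
  by rewrite row_mul rowK.
apply/rowP => c; have [_] := uv0 L c (leqnn L).
by rewrite /v eqxx mxE.
Qed.

End LargeRank.

(** The induction needs all [T] at once: a cancellation with threshold [T'] may lose [T'] in
    distance, so the shorter word must be far by [T + T']. The value of [T'] is what [spaced_far]
    requires for l+1 letters. *)
Lemma large_rank (l T : nat) : exists N, forall (n : nat) (F : finFieldType)
    (r : nat) (g : 'M[F]_n) (s : seq (('I_r * bool) * 'M[F]_n)),
  (N <= n)%N -> (size s <= l)%N -> const_SL g s -> letters s <> 1%g ->
  exists2 h, forall i, \det (h i) = 1 & far T (word_mx h g s).
Proof.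
elim: l T => [|l IHl] T; first by exists 0%N => n F r g [|a s] // _ _ _ [].
pose T' := (2 * (l.+2 * T.+1))%N.
have [N hN] := IHl (T + T')%N; exists (N + T'.+1)%N => n F r g s le_n le_s gs s1.
have ltT'n : (T' < n)%N by apply: leq_trans le_n; rewrite leq_addl.
have [sp|nsp] := boolP (sorted (spaced T') s).
  apply: spaced_far ltT'n _ gs sp.
    by rewrite leq_mul2l leq_mul2r /= ltnS le_s.
  by case: (s) s1.
have [g' [s' [szs gs' ls hs]]] := cancel_letters ltT'n gs nsp.
have [||//||h dh far_h] := hN n F r g' s'.
- exact: leq_trans (leq_addr _ _) le_n.
- by move: le_s; rewrite szs ltnS => /ltnW.
- by rewrite -ls.
exists h => //; have [|a a0 le_a] := hs h; last exact: far_perturb a0 le_a far_h.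
by move=> i; rewrite unitmxE dh unitr1.
Qed.

(** * Large fields *)

Section PolynomialFunctions.
Variable F : finFieldType.
Implicit Types (f : F -> F) (p : {poly F}).

(* The coefficient c of degree d may be 0. *)
Definition poly_fun d f c := exists p : {poly F},
  [/\ (size p <= d.+1)%N, p`_d = c & forall t, f t = p.[t]].

Lemma poly_fun_ext d f f' c : f =1 f' -> poly_fun d f c -> poly_fun d f' c.
Proof. by move=> ff' [p [sp pc pE]]; exists p; split=> // t; rewrite -ff'. Qed.

Lemma poly_fun_sum (I : finType) d (f : I -> F -> F) c :
  (forall k, poly_fun d (f k) (c k)) ->
  poly_fun d (fun t => \sum_k f k t) (\sum_k c k).
Proof.
move=> /choice[p hp]; exists (\sum_k p k); split.
- apply: leq_trans (size_sum _ _ _) _; apply/bigmax_leqP => k _.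
  by case: (hp k).
- by rewrite coef_sum; apply: eq_bigr => k _; case: (hp k).
- by move=> t; rewrite horner_sum; apply: eq_bigr => k _; case: (hp k).
Qed.

Lemma poly_funM d e f1 f2 c1 c2 : poly_fun d f1 c1 -> poly_fun e f2 c2 ->
  poly_fun (d + e) (fun t => f1 t * f2 t) (c1 * c2).
Proof.
move=> [p [sp <- pE]] [q [sq <- qE]]; exists (p * q); split.
- apply: leq_trans (size_polyMleq _ _) _; move: sp sq.
  by move: (size p) (size q); lia.
- have lt_d : (d < (d + e).+1)%N by rewrite ltnS leq_addr.
  rewrite coefM (bigD1 (Ordinal lt_d)) //= addKn big1 ?addr0 // => i.
  rewrite -val_eqE /= neq_ltn => /orP[lt_id|lt_di].
    by rewrite (nth_default 0 (s := q)) ?mulr0 //; apply: leq_trans sq _; lia.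
  by rewrite (nth_default 0 (s := p)) ?mul0r //; apply: leq_trans sp _.
- by move=> t; rewrite hornerM pE qE.
Qed.

Lemma poly_fun_const c : poly_fun 0 (fun=> c) c.
Proof.
by exists c%:P; split=> [||t]; rewrite ?size_polyC ?leq_b1 ?coefC ?hornerC.
Qed.

Lemma poly_fun_affine a b : poly_fun 1 (fun t => a + t * b) b.
Proof.
exists (a%:P + b *: 'X); split.
- apply: leq_trans (size_polyD _ _) _; rewrite geq_max.
  rewrite (leq_trans (size_polyC_leq1 _)) //=.
  by rewrite (leq_trans (size_scale_leq _ _)) ?size_polyX.
- by rewrite coefD coefC coefZ coefX /= add0r mulr1.
- by move=> t; rewrite !hornerE mulrC.
Qed.

Lemma poly_fun_eq0 d f c : (d < #|F|)%N -> poly_fun d f c ->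
  (forall t, f t = 0) -> c = 0.
Proof.
move=> ltd [p [sp <- pE]] f0; suff -> : p = 0 by rewrite coef0.
apply: contraTeq ltd => p0; rewrite -leqNgt cardE -ltnS.
apply: leq_trans sp; apply: max_poly_roots => //; last exact: enum_uniq.
by apply/allP => t _; rewrite rootE -pE f0.
Qed.

Definition poly_mx m n d (M : F -> 'M[F]_(m, n)) (C : 'M[F]_(m, n)) :=
  forall i j, poly_fun d (fun t => M t i j) (C i j).

Lemma poly_mxM m n k d e (M : F -> 'M_(m, n)) (N : F -> 'M_(n, k)) C D :
  poly_mx d M C -> poly_mx e N D -> poly_mx (d + e) (fun t => M t *m N t) (C *m D).
Proof.
move=> MC ND i j; rewrite mxE.
apply: (@poly_fun_ext _ (fun t => \sum_k M t i k * N t k j)).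
  by move=> t; rewrite mxE.
by apply: poly_fun_sum => l; apply: poly_funM.
Qed.

Lemma poly_mx_const m n (C : 'M[F]_(m, n)) : poly_mx 0 (fun=> C) C.
Proof. by move=> i j; apply: poly_fun_const. Qed.

Lemma poly_mx_affine m n (A B : 'M[F]_(m, n)) : poly_mx 1 (fun t => A + t *: B) B.
Proof.
move=> i j; apply: poly_fun_ext (poly_fun_affine (A i j) (B i j)) => t.
by rewrite !mxE.
Qed.

(** Being scalar is linear in the entries. Each such condition is a polynomial of degree at most d <
    q vanishing on all of F, hence zero in every coefficient. *)
Lemma poly_mx_scalar n d (M : F -> 'M[F]_n) C : (d < #|F|)%N -> (0 < n)%N ->
  poly_mx d M C -> (forall t, exists a, M t = a%:M) -> exists a, C = a%:M.
Proof.
case: n M C => // n M C ltd _ MC scalM.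
exists (C 0 0); apply/matrixP => i j; rewrite mxE.
have [<-|ij] := eqVneq i j; last first.
  apply: poly_fun_eq0 ltd (MC i j) _ => t; have [a ->] := scalM t.
  by rewrite mxE (negPf ij).
have [p [sp <- pE]] := MC i i; have [q [sq <- qE]] := MC 0 0.
rewrite mulr1n; apply/eqP; rewrite -subr_eq0 -coefB; apply/eqP.
apply: (poly_fun_eq0 ltd (f := fun t => (p - q).[t])).
  exists (p - q); split=> //; apply: leq_trans (size_polyD _ _) _.
  by rewrite size_polyN geq_max sp.
move=> t; rewrite hornerD hornerN -pE -qE; have [a ->] := scalM t.
by rewrite !mxE !eqxx subrr.
Qed.

End PolynomialFunctions.

Section LargeField.
Variables (F : finFieldType) (n : nat).
Hypothesis n_gt1 : (1 < n)%N.

(** * Generic transvections *)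

Section GenericTransvections.
Variable I : finType.

Let params := ((I -> 'rV[F]_n) * (I -> 'M[F]_n))%type.
Implicit Types P Q : params.

Let line P Q t : params :=
  (fun x => P.1 x + t *: (Q.1 x - P.1 x), fun x => P.2 x + t *: (Q.2 x - P.2 x)).

Let line0 P Q : line P Q 0 = P.
Proof.
by case: P => v B; congr pair; apply/funext => x; rewrite scale0r addr0.
Qed.

Let line1 P Q : line P Q 1 = Q.
Proof.
by case: Q => v B; congr pair; apply/funext => x; rewrite scale1r addrC subrK.
Qed.

(* Restriction to lines stands in for multivariate polynomials: a function   *)
(* nonzero somewhere is nonzero as a polynomial on a line through that point. *)
Let poly_line d (f : params -> F) :=
  forall P Q, exists c, poly_fun d (fun t => f (line P Q t)) c.

Let poly_lineM d e f1 f2 : poly_line d f1 -> poly_line e f2 ->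
  poly_line (d + e) (fun P => f1 P * f2 P).
Proof.
move=> h1 h2 P Q; have [c1 hc1] := h1 P Q; have [c2 hc2] := h2 P Q.
by exists (c1 * c2); apply: poly_funM.
Qed.

(** On the line joining a non-zero of [f1] to a non-zero of [f2], both restrictions are non-zero
    polynomials, and their product has fewer than q roots. *)
Let poly_line_common d e f1 f2 : poly_line d f1 -> poly_line e f2 ->
  (d + e < #|F|)%N -> (exists P, f1 P != 0) -> (exists Q, f2 Q != 0) ->
  exists P, f1 P * f2 P != 0.
Proof.
move=> h1 h2 lt_de [P P0] [Q Q0]; apply: contrapT => noR.
have [c1 [p1 [sp1 _ p1E]]] := h1 P Q; have [c2 [p2 [sp2 _ p2E]]] := h2 P Q.
have p1_0 : p1 != 0.
  by apply: contraNneq P0 => p0; rewrite -(line0 P Q) p1E p0 horner0.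
have p2_0 : p2 != 0.
  by apply: contraNneq Q0 => p0; rewrite -(line1 P Q) p2E p0 horner0.
have : p1 * p2 == 0; last by rewrite mulf_eq0 (negPf p1_0) (negPf p2_0).
apply: contraTT lt_de => p12; rewrite -leqNgt cardE -ltnS.
apply: (@leq_trans (size (p1 * p2))); last first.
  apply: leq_trans (size_polyMleq _ _) _; move: sp1 sp2.
  by move: (size p1) (size p2); lia.
apply: max_poly_roots => //; last exact: enum_uniq.
apply/allP => t _; rewrite rootE hornerM -p1E -p2E.
by apply/negPn/negP => nz; apply: noR; exists (line P Q t).
Qed.

(** An alternating form yields columns killed by [v] in every characteristic, polynomially in
    unconstrained parameters. *)
Definition alt_col (B : 'M[F]_n) (v : 'rV[F]_n) := (B - B^T) *m v^T.

Lemma mul_alt_col B v : v *m alt_col B v = 0.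
Proof.
rewrite /alt_col mulmxBl mulmxBr !mulmxA.
have -> : v *m B^T *m v^T = (v *m B *m v^T)^T by rewrite !trmx_mul trmxK mulmxA.
by rewrite [v *m B *m v^T]mx11_scalar tr_scalar_mx subrr.
Qed.

Lemma alt_col_delta i j (u v : 'rV[F]_n) :
  (u *m alt_col (delta_mx j i) v) 0 0 = u 0 j * v 0 i - u 0 i * v 0 j.
Proof.
have uvE k l : (u *m delta_mx k l *m v^T) 0 0 = u 0 k * v 0 l.
  rewrite -(mul_delta_mx (0 : 'I_1)) mulmxA -colE -mulmxA -rowE mxE big_ord1.
  by rewrite !mxE.
by rewrite /alt_col trmx_delta mulmxBl mulmxBr !mulmxA mxE uvE mxE uvE.
Qed.

(** Otherwise every vector is an eigenvector: basis vectors make g diagonal, and sums of two of them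
    equate the diagonal entries. *)
Lemma nonscalar_minor (g : 'M[F]_n) : far 0 g ->
  exists (v : 'rV[F]_n) i j, (v *m g) 0 j * v 0 i - (v *m g) 0 i * v 0 j != 0.
Proof.
move=> far_g; apply: contrapT => all0.
have minor0 (v : 'rV[F]_n) i j : (v *m g) 0 j * v 0 i = (v *m g) 0 i * v 0 j.
  apply/eqP; rewrite -subr_eq0; apply/negPn/negP => nz.
  by apply: all0; exists v, i, j.
pose i0 := Ordinal (ltnW n_gt1).
suff gE : g = (g i0 i0)%:M.
  by have /forallP/(_ (g i0 i0)) := far_g; rewrite -gE subrr mxrank0.
apply/matrixP => i j; rewrite mxE.
have rowE k : delta_mx 0 k *m g = row k g by rewrite rowE.
have off k l : k != l -> g k l = 0.
  move=> kl; have := minor0 (delta_mx 0 k) k l; rewrite rowE !mxE !eqxx.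
  by rewrite mulr1 eq_sym (negPf kl) mulr0.
have [<-|ij] := eqVneq i j; last by rewrite off.
have [->//|ii0] := eqVneq i i0.
have := minor0 (delta_mx 0 i + delta_mx 0 i0) i i0.
have i0i : i0 != i by rewrite eq_sym.
rewrite mulmxDl !rowE !mxE !eqxx (off _ _ ii0) (off _ _ i0i).
by rewrite (negPf ii0) (negPf i0i) /= addr0 !add0r addr0 !mulr1.
Qed.

Definition pairing P (x : I) (g : 'M[F]_n) (y : I) :=
  (P.1 x *m g *m alt_col (P.2 y) (P.1 y)) 0 0.

(** Degree three, since [P.1 x], [P.2 y] and [P.1 y] each enter linearly. *)
Lemma poly_pairing x g y : poly_line 3 (fun P => pairing P x g y).
Proof.
move=> P Q.
set A := Q.2 y - P.2 y.
have := poly_mxM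
  (poly_mxM (poly_mx_affine (P.1 x) (Q.1 x - P.1 x)) (poly_mx_const g))
  (poly_mxM (poly_mx_affine (P.2 y - (P.2 y)^T) (A - A^T))
     (poly_mx_affine (P.1 y)^T (Q.1 y - P.1 y)^T)).
move=> /(_ 0 0) h; eexists; apply: poly_fun_ext h => t.
have trE m k (X Y : 'M[F]_(m, k)) : (X + t *: Y)^T = X^T + t *: Y^T.
  by apply/matrixP => i j; rewrite !mxE.
by rewrite /pairing /alt_col /= -/A !trE (scalerBr t A) opprD addrACA.
Qed.

Lemma pairing_neq0 x g y : g \in unitmx -> (x == y) ==> far 0 g ->
  exists P, pairing P x g y != 0.
Proof.
move=> ug; have [<- /=|xy _] := eqVneq x y.
  case/nonscalar_minor => v [i [j nz]]; exists (fun=> v, fun=> delta_mx j i).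
  by rewrite /pairing alt_col_delta.
pose i0 := Ordinal (ltnW n_gt1); pose i1 := Ordinal n_gt1.
exists (fun z => if z == x then delta_mx 0 i0 *m invmx g else delta_mx 0 i1,
  fun=> delta_mx i0 i1).
rewrite /pairing /= eqxx (eq_sym y) (negPf xy) mulmxKV // alt_col_delta !mxE !eqxx.
by rewrite mulr1 mulr0 subr0 oner_eq0.
Qed.

Lemma generic_params (cs : seq (I * 'M[F]_n * I)) :
    (3 * size cs < #|F|)%N ->
    {in cs, forall c, c.1.2 \in unitmx /\ (c.1.1 == c.2) ==> far 0 c.1.2} ->
  exists P, {in cs, forall c, pairing P c.1.1 c.1.2 c.2 != 0}.
Proof.
move=> ltq ok_cs.
pose f P (cs : seq (I * 'M[F]_n * I)) := \prod_(c <- cs) pairing P c.1.1 c.1.2 c.2.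
suff [_ [P fP]] : poly_line (3 * size cs) (f^~ cs) /\ exists P, f P cs != 0.
  by exists P; move: fP; rewrite prodf_seq_neq0 => /allP h c /h.
elim: cs ltq ok_cs => [|c cs IHcs] ltq ok_cs.
  split; last by exists (fun=> 0, fun=> 0); rewrite /f big_nil oner_eq0.
  move=> P Q; exists 1; apply: poly_fun_ext (poly_fun_const 1) => t.
  by rewrite /f big_nil.
have [||hf exf] := IHcs.
  by apply: leq_ltn_trans ltq; rewrite leq_mul2l leqnSn orbT.
  by move=> d dcs; apply: ok_cs; rewrite inE dcs orbT.
have fE P : f P (c :: cs) = pairing P c.1.1 c.1.2 c.2 * f P cs by rewrite /f big_cons.
have [uc fc] := ok_cs c (mem_head _ _).
rewrite (_ : f^~ (c :: cs) = fun P => pairing P c.1.1 c.1.2 c.2 * f P cs); last first.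
  exact/funext.
split; first by rewrite mulnS; apply: poly_lineM hf; apply: poly_pairing.
have lt_deg : (3 + 3 * size cs < #|F|)%N by rewrite -mulnS.
have [P PP] := poly_line_common (poly_pairing c.1.1 c.1.2 c.2) hf lt_deg
  (pairing_neq0 uc fc) exf.
by exists P; rewrite fE.
Qed.

End GenericTransvections.
(** A case of det(1 + c v) = 1 + v c, read off two factorizations into block triangular matrices. *)
Lemma det_transvection (c : 'cV[F]_n) (v : 'rV[F]_n) :
  v *m c = 0 -> \det (1%:M + c *m v) = 1.
Proof.
move=> vc0.
have E : block_mx 1%:M 0 (- c) 1%:M *m block_mx 1%:M v 0 (1%:M + c *m v) =
    block_mx (1%:M : 'M[F]_1) v 0 1%:M *m block_mx 1%:M 0 (- c) 1%:M.
  rewrite !mulmx_block !mul1mx !mulmx1 !mul0mx !addr0 !add0r.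
  by rewrite mulmxN vc0 oppr0 addr0 mulNmx addrCA addNr addr0.
have := congr1 determinant E; rewrite !det_mulmx !det_lblock !det_ublock.
by rewrite !det1 !mul1r.
Qed.

(** * The leading coefficient of a substituted word *)

Section Substitution.
Variable r : nat.
Implicit Types (x : 'I_r * bool) (s : seq (('I_r * bool) * 'M[F]_n)).
Variables (v : 'I_r * bool -> 'rV[F]_n) (c : 'I_r * bool -> 'cV[F]_n).
Hypothesis vc0 : forall x, v x *m c x = 0.

Let flip x := (x.1, ~~ x.2).
Let E x := c x *m v x.
Let tv x a := 1%:M + a *: E x.
(** With one transvection per sign, every letter x, inverse or not, has leading coefficient
    [E (flip x) *m E x]. Adjacent letters x, y with constant g between them thus meet in
    [v x *m g *m c (flip y)], and flip y = x exactly when y is the inverse of x. *)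
Let h t i := tv (i, false) t *m tv (i, true) t.

Let E2 x : E x *m E x = 0.
Proof. by rewrite /E -mulmxA (mulmxA (v x)) vc0 mul0mx mulmx0. Qed.

Let tvN x a : tv x a *m tv x (- a) = 1%:M.
Proof.
rewrite /tv mulmxDr mulmx1 mulmxDl mul1mx -scalemxAl -scalemxAr E2.
by rewrite !scaler0 addr0 scaleNr addrK.
Qed.

Let det_h t i : \det (h t i) = 1.
Proof.
by rewrite det_mulmx /tv /E !scalemxAl !det_transvection ?mulr1 // -scalemxAr vc0
  scaler0.
Qed.

Let letter_h t x :
  letter_mx (h t) x = tv (flip x) ((-1) ^+ (~~ x.2) * t) *m tv x ((-1) ^+ (~~ x.2) * t).
Proof.
case: x => i [] /=; rewrite /letter_mx /= ?expr0 ?expr1 ?mul1r //.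
set X := _ *m _; have hu : h t i \in unitmx by rewrite unitmxE det_h unitr1.
suff hX : h t i *m X = 1%:M by rewrite -[RHS]mul1mx -(mulVmx hu) -mulmxA hX mulmx1.
by rewrite /X /h mulN1r -mulmxA (mulmxA (tv (i, true) t)) tvN mul1mx tvN.
Qed.

Let letter_lead x : poly_mx 2 (fun t => letter_mx (h t) x) (E (flip x) *m E x).
Proof.
have tv_lead y b : poly_mx 1 (fun t => tv y ((-1) ^+ b * t)) ((-1) ^+ b *: E y).
  move=> i j; apply: poly_fun_ext (poly_mx_affine 1%:M ((-1) ^+ b *: E y) i j) => t.
  by rewrite /tv scalerA mulrC.
move=> i j; have := poly_mxM (tv_lead (flip x) (~~ x.2)) (tv_lead x (~~ x.2)) i j.
rewrite -scalemxAl -scalemxAr scalerA -expr2 sqrr_sign scale1r.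
by apply: poly_fun_ext => t; rewrite letter_h.
Qed.

Let lead (A : 'M[F]_n) s := foldl (fun A a => A *m (E (flip a.1) *m E a.1) *m a.2) A s.

Let leadZ y A s : lead (y *: A) s = y *: lead A s.
Proof. by elim: s A => //= d s IH A; rewrite -!scalemxAl IH. Qed.

Let word_lead d (M : F -> 'M[F]_n) A s : poly_mx d M A ->
  poly_mx (d + 2 * size s) (fun t => word_mx (h t) (M t) s) (lead A s).
Proof.
elim: s d M A => [|a s IHs] d M A MA; first by rewrite muln0 addn0.
rewrite /= mulnS addnA.
apply: (IHs _ (fun t => M t *m letter_mx (h t) a.1 *m a.2)).
rewrite -[(d + 2)%N]addn0; apply: poly_mxM (poly_mx_const _).
exact: poly_mxM MA (letter_lead _).
Qed.

Let link (a b : ('I_r * bool) * 'M[F]_n) :=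
  (v a.1 *m a.2 *m c (flip b.1)) 0 0 != 0.

(** Neighbouring rank-one factors collapse to non-zero scalars; only the first column and the last
    row survive. *)
Let lead_rank1 (u : 'cV[F]_n) a s :
  path link a s -> {in s, forall b, (v (flip b.1) *m c b.1) 0 0 != 0} ->
  exists2 k, k != 0 & lead (u *m v a.1 *m a.2) s =
    k *: (u *m v (last a s).1 *m (last a s).2).
Proof.
elim: s a u => [|b s IHs] a u /=; first by exists 1; rewrite ?oner_eq0 ?scale1r.
move=> /andP[ab bs] vc_s.
have [||k k0 kE] := IHs b u; [exact: bs | |].
  by move=> d ds; apply: vc_s; rewrite inE ds orbT.
have vcb := vc_s b (mem_head _ _).
exists ((v a.1 *m a.2 *m c (flip b.1)) 0 0 * (v (flip b.1) *m c b.1) 0 0 * k).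
  by rewrite !mulf_neq0.
rewrite -scalerA -kE -leadZ; congr lead.
have -> : u *m v a.1 *m a.2 *m (E (flip b.1) *m E b.1) *m b.2 =
  u *m (v a.1 *m a.2 *m c (flip b.1)) *m (v (flip b.1) *m c b.1) *m v b.1 *m b.2.
  by rewrite /E !mulmxA.
rewrite [X in u *m X]mx11_scalar [X in _ *m X *m v b.1]mx11_scalar.
by rewrite !mul_mx_scalar -!scalemxAl scalerA mulrC.
Qed.

(** If all values were scalar, so would be the leading coefficient; but that has rank exactly one,
    and n > 1. *)
Lemma substitution_nonscalar g a s :
    (2 * size (a :: s) < #|F|)%N -> const_SL g (a :: s) -> path link a s ->
    {in a :: s, forall b, (v (flip b.1) *m c b.1) 0 0 != 0} ->
    {in a :: s, forall b, (v b.1 *m c (flip b.1)) 0 0 != 0} ->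
  exists2 h, forall i, \det (h i) = 1 & far 0 (word_mx h g (a :: s)).
Proof.
move=> ltq [dg ds] lk vc1 vc2.
have v0 b : b \in a :: s -> v b.1 != 0.
  by move=> /vc2; apply: contraNneq => ->; rewrite mul0mx mxE.
have c0 b : b \in a :: s -> c (flip b.1) != 0.
  by move=> /vc2; apply: contraNneq => ->; rewrite mulmx0 mxE.
suff [t far_t] : exists t, far 0 (word_mx (h t) g (a :: s)) by exists (h t).
apply: contrapT => no_t.
have scal t : exists b, word_mx (h t) g (a :: s) = b%:M.
  apply: contrapT => no_b; apply: no_t; exists t; apply/forallP => b.
  by rewrite lt0n mxrank_eq0 subr_eq0; apply/eqP => wb; apply: no_b; exists b.
have [b leadE] := poly_mx_scalar ltq (ltnW n_gt1)
  (word_lead (a :: s) (poly_mx_const g)) scal.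
have [|k k0 kE] := lead_rank1 (g *m c (flip a.1)) lk.
  by move=> d d_s; apply: vc1; rewrite inE d_s orbT.
pose y := (v (flip a.1) *m c a.1) 0 0.
have y0 : y != 0 := vc1 a (mem_head _ _).
pose z := last a s; have zs : z \in a :: s by exact: mem_last.
have ug : g \in unitmx by rewrite unitmxE dg unitr1.
have uz : z.2 \in unitmx by rewrite unitmxE ds // unitr1.
have {}leadE : y *: (k *: (g *m c (flip a.1) *m v z.1 *m z.2)) = b%:M.
  rewrite -kE -leadE -leadZ /=; congr (lead _ s).
  rewrite /E !mulmxA -(mulmxA _ (v (flip a.1))) [v _ *m c a.1]mx11_scalar.
  by rewrite mul_mx_scalar -!scalemxAl.
have : (\rank (b%:M : 'M[F]_n) <= 1)%N.
  rewrite -leadE !mxrank_scale_nz // -mulmxA.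
  apply: leq_trans (mxrankM_maxl _ _) _; exact: rank_leq_col.
have [b0|b0] := eqVneq b 0; last first.
  rewrite mxrank_unit; first by rewrite leqNgt n_gt1.
  by rewrite unitmxE det_scalar unitrX // unitfE.
move=> _; move: leadE; rewrite b0 raddf0 => /eqP.
rewrite !scaler_eq0 (negPf y0) (negPf k0) /= => /eqP gz0.
have cv0 : c (flip a.1) *m v z.1 = 0.
  apply: (can_inj (mulKmx ug)); apply: (can_inj (mulmxK uz)).
  by rewrite mulmxA gz0 mulmx0 mul0mx.
have /matrix0Pn[i [j vij]] := v0 _ zs.
have /matrix0Pn[i' [j' cij]] := c0 _ (mem_head a s).
move/matrixP/(_ i' j): cv0; rewrite !mxE big_ord1 => /eqP.
rewrite mulf_eq0; move: vij cij; rewrite (ord1 i) (ord1 j').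
by move=> /negPf-> /negPf->.
Qed.

End Substitution.
Lemma path_zip (T : eqType) (e : rel T) a s :
  path e a s = all (fun p => e p.1 p.2) (zip (a :: s) s).
Proof. by elim: s a => //= b s IHs a; rewrite IHs. Qed.

Lemma zip_subset (T1 T2 : eqType) (s : seq T1) (t : seq T2) p :
  p \in zip s t -> p.1 \in s.
Proof.
elim: s t => [|a s IHs] [|b t] //=.
by rewrite !inE => /predU1P[->|/IHs ->]; rewrite ?eqxx ?orbT.
Qed.

(** Three families of at most [size s] pairings of degree 3 must be non-zero together, whence the
    factor 9. *)
Lemma spaced0_far r g (s : seq (('I_r * bool) * 'M[F]_n)) :
    (9 * size s < #|F|)%N -> (0 < size s)%N -> const_SL g s ->
    sorted (spaced 0) s ->
  exists2 h, forall i, \det (h i) = 1 & far 0 (word_mx h g s).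
Proof.
case: s => // a s ltq _ gs; rewrite [sorted _ _]path_zip => /allP sp.
have ds b : b \in a :: s -> b.2 \in unitmx.
  by case: gs => _ ds /ds db; rewrite unitmxE db unitr1.
pose flip (x : 'I_r * bool) := (x.1, ~~ x.2).
have flipF x : (flip x == x) = false.
  by case: x => i b; rewrite xpair_eqE eqxx; case: b.
(* The first two families keep the outer factors of the leading coefficient *)
(* nonzero as well.                                                         *)
pose cs : seq (('I_r * bool) * 'M[F]_n * ('I_r * bool)) :=
  [seq (flip b.1, 1%:M, b.1) | b <- a :: s] ++
  [seq (b.1, 1%:M, flip b.1) | b <- a :: s] ++
  [seq (p.1.1, p.1.2, flip p.2.1) | p <- zip (a :: s) s].
have [||[v B] nz] := @generic_params ('I_r * bool)%type cs.
- apply: leq_ltn_trans ltq; rewrite !size_cat !size_map size_zip /=.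
  by rewrite (minn_idPr (leqnSn _)); move: (size s); lia.
- move=> c; rewrite !mem_cat => /or3P[] /mapP[b bs ->] /=.
  + by rewrite unitmx1 flipF.
  + by rewrite unitmx1 eq_sym flipF.
  + rewrite ds; last exact: zip_subset bs.
    split=> //; apply/implyP => /eqP b12; have := sp b bs.
    by rewrite /spaced b12 /flip /= negbK -surjective_pairing eqxx.
apply: (@substitution_nonscalar r v (fun x => alt_col (B x) (v x))) => //.
- by move=> x; apply: mul_alt_col.
- by apply: leq_ltn_trans ltq; rewrite leq_mul2r orbT.
- rewrite path_zip; apply/allP => p ps; rewrite -/(flip _).
  apply: (nz (p.1.1, p.1.2, flip p.2.1)).
  by rewrite !mem_cat; apply/or3P/Or33/mapP; exists p.
- move=> b bs; have := nz (flip b.1, 1%:M, b.1); rewrite /pairing /= mulmx1; apply.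
  by rewrite !mem_cat; apply/or3P/Or31/mapP; exists b.
- move=> b bs; have := nz (b.1, 1%:M, flip b.1); rewrite /pairing /= mulmx1; apply.
  by rewrite !mem_cat; apply/or3P/Or32/mapP; exists b.
Qed.

(** For T = 0 cancellation is exact up to a non-zero scalar, so repeating it costs nothing and the
    same bound on q serves throughout. *)
Lemma large_field r g (s : seq (('I_r * bool) * 'M[F]_n)) :
    (9 * size s < #|F|)%N -> const_SL g s -> letters s <> 1%g ->
  exists2 h, forall i, \det (h i) = 1 & far 0 (word_mx h g s).
Proof.
have [m] := ubnP (size s); elim: m => // m IHm in g s *.
rewrite ltnS => le_sm ltq gs s1.
have [sp|nsp] := boolP (sorted (spaced 0) s).
  by apply: spaced0_far gs sp => //; case: (s) s1.
have [g' [s' [szs gs' ls hs]]] := cancel_letters (ltnW n_gt1) gs nsp.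
have [||//||h dh far_h] := IHm g' s'.
- by rewrite (leq_trans _ le_sm) // szs.
- by apply: leq_ltn_trans ltq; rewrite leq_mul2l szs !leqW.
- by rewrite -ls.
exists h => //; have [|b b0 le_b] := hs h; last first.
  exact: (far_perturb (T := 0) b0 le_b far_h).
by move=> i; rewrite unitmxE dh unitr1.
Qed.

End LargeField.

(** * From matrices to PSL *)

Lemma monoid_morphismV (G H : groupType) (f : G -> H) x :
  monoid.monoid_morphism f -> f x^-1%g = (f x)^-1%g.
Proof.
move=> [f1 fM]; apply: (mulIg (f x)).
by rewrite -fM !mulVg f1.
Qed.

Section Transfer.
Variables (n : nat) (F : finFieldType).
Hypothesis n_gt1 : (1 < n)%N.
Let M := 'M[F]_n.-1.+1.
Let G : groupType := [subg PSL n F].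

(** Non-invertible matrices go to 1; the facts below assume determinant one. *)
Let toGL (A : M) : {'GL_n[F]} := insubd (1%g : {'GL_n[F]}) A.

Let toGL_val A : \det A = 1 -> GLval (toGL A) = A.
Proof.
move=> dA; have uA : A \in unitmx by rewrite unitmxE dA unitr1.
exact: (insubdK _ uA).
Qed.

Let toGL_SL A : \det A = 1 -> toGL A \in SL n F.
Proof. by move=> dA; rewrite inE toGL_val // dA. Qed.

Let toGLM A B : \det A = 1 -> \det B = 1 -> toGL (A *m B) = (toGL A * toGL B)%g.
Proof.
move=> dA dB; have dAB : \det (A *m B) = 1 by rewrite det_mulmx dA dB mulr1.
have E : GLval (toGL (A *m B)) = GLval (toGL A * toGL B)%g.
  by rewrite GL_ME !toGL_val.
exact: val_inj E.
Qed.

(** For non-scalar u there are v, c with v c = 0 and v u c non-zero. Commuting with the transvection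
    1 + c v and multiplying by v on the left gives (v u c) v = 0. *)
Lemma center_SL_scalar u : u \in 'Z(SL n F)%g -> ~~ far 0 (GLval u).
Proof.
case/centerP => uSL cu; apply/negP => far_u.
have m_gt1 : (1 < n.-1.+1)%N by case: (n) n_gt1.
have [v [i [j]]] := nonscalar_minor m_gt1 far_u.
rewrite -alt_col_delta; have := mul_alt_col (delta_mx j i) v.
move: (alt_col _ v) => c vc0 nz.
have dT := det_transvection vc0.
have := cu _ (toGL_SL dT); move/(congr1 (fun w => v *m GLval w)).
rewrite !GL_ME toGL_val // -!mulmxE mulmxDr mulmxDl mulmx1 mul1mx !mulmxDr.
move/addrI; rewrite !mulmxA vc0 !mul0mx [v *m _ *m c]mx11_scalar mul_scalar_mx.
move/eqP; rewrite scaler_eq0 (negPf nz) /= => /eqP v0.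
by move: nz; rewrite v0 !mul0mx mxE eqxx.
Qed.

Let proj (A : M) : [subg PSL n F] := subg (PSL n F) (coset 'Z(SL n F)%g (toGL A)).

Let normSL A : \det A = 1 -> toGL A \in 'N('Z(SL n F))%g.
Proof.
move=> dA; apply: (fintype.subsetP (normal_norm (center_normal [group of SL n F]))).
exact: toGL_SL.
Qed.

Let projM A B : \det A = 1 -> \det B = 1 -> proj (A *m B) = (proj A * proj B)%g.
Proof.
move=> dA dB; rewrite /proj toGLM // morphM ?normSL // subgM //.
  by apply: mem_quotient; apply: toGL_SL.
by apply: mem_quotient; apply: toGL_SL.
Qed.

Let proj1 : proj 1%:M = 1%g.
Proof. by apply: (mulIg (proj 1%:M)); rewrite -projM ?det1 // mulmx1 mul1g. Qed.

Let proj_eq1 A : \det A = 1 -> proj A = 1%g -> ~~ far 0 A.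
Proof.
move=> dA /(congr1 sgval); rewrite subgK; last first.
  by apply: mem_quotient; apply: toGL_SL.
by move=> /coset_idr h; rewrite -(toGL_val dA); apply: center_SL_scalar; apply: h;
  exact: normSL.
Qed.

Let proj_surj (g : G) : exists A : M, \det A = 1 /\ proj A = g.
Proof.
have /morphimP[u _ uSL gE] := subgP g.
exists (GLval u); have du : \det (GLval u) = 1 by move: uSL; rewrite inE => /eqP.
split=> //; rewrite /proj (_ : toGL (GLval u) = u) -?gE ?sgvalK //.
have E : GLval (toGL (GLval u)) = GLval u by rewrite toGL_val.
exact: val_inj E.
Qed.

(** Evaluation commutes with the projection from SL, and the augmentation of a word is [letters] of
    its lift. A short non-singular identity would thus lift to a word with only scalar values. *)
Lemma not_mixed_identity (l : nat) :
    (forall r g (s : seq (('I_r * bool) * M)), (size s <= l)%N -> const_SL g s ->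
       letters s <> 1%g ->
       exists2 h, forall i, \det (h i) = 1 & far 0 (word_mx h g s)) ->
  (l < shortest_nonsingular_length [subg PSL n F])%N.
Proof.
move=> far_word; rewrite ltnNge; apply/negP => le_l.
move: le_l; rewrite /shortest_nonsingular_length; case: ex_minnP => k.
move=> /asboolP[r [w [_ [[_ w1] nsing] <-]]] _ le_l.
move: le_l; rewrite /mixed_length; case: ex_minnP => {}k.
move=> /asboolP[s [sE <-]] _ le_l.
have /choice[rep repP] := proj_surj.
(* Constants accumulate in the head; a letter takes the current head as the constant that follows it
   and restarts with 1. *)
pose fix conv (s : seq (G + 'I_r * bool)) : M * seq (('I_r * bool) * M) :=
  match s with
  | [::] => (1%:M, [::])
  | inl g :: s' => (rep g *m (conv s').1, (conv s').2)
  | inr x :: s' => (1%:M, (x, (conv s').1) :: (conv s').2)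
  end.
have conv_SL t : const_SL (conv t).1 (conv t).2.
  elim: t => [|[g|x] t [IH1 IH2]] /=; first by split; rewrite ?det1.
    by split=> //; rewrite det_mulmx IH1 mulr1; case: (repP g).
  split; first exact: det1.
  by move=> a; rewrite inE => /predU1P[->|/IH2].
have conv_size t : size (conv t).2 = count (fun a => ~~ is_inl a) t.
  by elim: t => [|[g|x] t IH] //=; rewrite IH.
have aug := augmentation_morphism G r.
have conv_letters t :
    augmentation (\prod_(a <- t) mixed_letter a)%g = letters (conv t).2.
  elim: t => [|a t IH]; first by rewrite big_nil aug.1.
  rewrite big_cons aug.2 IH; case: a => [g|[i b]] /=.
    by rewrite augmentation_const mul1g.
  rewrite /letters /= -cat1s pword_cat; congr (_ * _)%g.
  by case: b; rewrite ?(monoid_morphismV _ aug) augmentation_free // free_genV.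
have [||h dh far_h] := far_word r _ _ _ (conv_SL s).
- by rewrite conv_size.
- by rewrite -conv_letters sE.
have dl x : \det (letter_mx h x) = 1.
  by rewrite /letter_mx; case: x.2; rewrite ?det_inv dh ?invr1.
have dw g t : const_SL g t -> \det (word_mx h g t) = 1.
  elim: t g => [|a t IH] g /= [dg dt] //; apply: IH; split.
    by rewrite !det_mulmx dg dl dt ?mem_head // !mulr1.
  by move=> b bt; apply: dt; rewrite inE bt orbT.
have ev := mixed_eval_morphism (fun i => proj (h i)).
have evalE t : mixed_eval (fun i => proj (h i)) (\prod_(a <- t) mixed_letter a)%g =
    proj (word_mx h (conv t).1 (conv t).2).
  elim: t => [|a t IH]; first by rewrite big_nil ev.1 -proj1.
  rewrite big_cons ev.2 IH; case: a => [g|x] /=.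
    have [dg pg] := repP g.
    by rewrite mixed_eval_const word_mxM projM ?pg ?dw.
  transitivity (proj (letter_mx h x *m word_mx h (conv t).1 (conv t).2)).
    rewrite projM ?dw //; congr (_ * _)%g.
    rewrite /letter_mx; case: x => i [] /=; first by rewrite mixed_eval_gen.
    rewrite (monoid_morphismV _ ev) mixed_eval_gen; apply: (mulIg (proj (h i))).
    rewrite mulVg -projM ?det_inv ?dh ?invr1 // mulVmx ?proj1 //.
    by rewrite unitmxE dh unitr1.
  by rewrite -word_mxM /= mul1mx.
have := proj_eq1 (dw _ _ (conv_SL s)).
by rewrite -evalE sE w1 far_h => /(_ erefl).
Qed.

End Transfer.

(** * Finiteness of the exceptional pairs *)

Local Open Scope classical_set_scope.

Theorem corollary3 (l : nat) (hl : (1 <= l)%N) :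
  finite_set
    [set nq : nat * nat |
      [/\ (2 <= nq.1)%N, prime_power nq.2 &
          exists F : finFieldType,
            #|F| = nq.2 /\
            (shortest_nonsingular_length [subg PSL nq.1 F] <= l)%N]].
Proof.
have [N hN] := large_rank l 0.
apply: (@sub_finite_set _ _ (`I_N `*` `I_(9 * l).+1)); last first.
  by apply: finite_setX; apply: finite_II.
move=> [n q] /= [n_gt1 _ [F [<- le_l]]]; split=> /=.
  rewrite ltnNge; apply: contraL le_l => le_Nn; rewrite -ltnNge.
  apply: not_mixed_identity => // r g s le_s; apply: hN => //.
  (* The matrices behind [PSL n F] have size n.-1.+1, which is n here. *)
  by apply: leq_trans le_Nn _; case: (n) n_gt1.
rewrite ltnNge; apply: contraL le_l => lt_q; rewrite -ltnNge.
apply: not_mixed_identity => // r g s le_s; apply: large_field.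
  by case: (n) n_gt1.
by apply: leq_ltn_trans lt_q; rewrite leq_mul2l le_s orbT.
Qed.
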